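(* Let $\mathbf{A}\in\mathbb{R}^{m\times d}$, $\mathbf{b}\in\mathbb{R}^m$, $\mathbf{c}\in\mathbb{R}^d$, and assume that there exists $\lambda_0\in\mathbb{R}^m$ such that $\mathbf{A}^T\lambda_0>0$ (componentwise). Then for every fixed $\varepsilon>0$, the function $G_\varepsilon:\mathbb{R}^m\to\mathbb{R}$, $G_\varepsilon(\lambda)=\inf_{x\in\mathbb{R}^d}\mathcal{L}_\varepsilon(x,\lambda)$, is concave, differentiable, and satisfies, for all $\lambda\in\mathbb{R}^m$, $$G_\varepsilon(\lambda)=\mathcal{L}_\varepsilon(x^*(\lambda),\lambda)=\mathbf{b}^T\lambda-\varepsilon\sum_{i=1}^d x^*_i(\lambda),\qquad \nabla G_\varepsilon(\lambda)=\mathbf{b}-\mathbf{A}\,x^*(\lambda),$$ where $x^*(\lambda)\in\mathbb{R}^d$ has coordinates $$x^*_i(\lambda):=\exp\big((\mathbf{A}^T\lambda-\mathbf{c})_i/\varepsilon-1\big)>0,\qquad i=1,\ldots,d.$$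
   Context: Let $f:\mathbb{R}^d\to\mathbb{R}\cup\{+\infty\}$ be $f(x):=\sum_{i=1}^d x_i\ln(x_i)$ if $x\geq0$ (componentwise), with the convention $0\ln(0)=0$, and $f(x):=+\infty$ otherwise. For $\varepsilon>0$ the Lagrangian is $$\mathcal{L}_\varepsilon(x,\lambda):=\mathbf{c}^Tx+\lambda^T(\mathbf{b}-\mathbf{A}x)+\varepsilon f(x),\qquad (x,\lambda)\in\mathbb{R}^d\times\mathbb{R}^m.$$ *)

(* Defs.v *)
From mathcomp Require Import all_boot all_order all_algebra.
From mathcomp Require Import all_classical all_reals all_analysis.

Set Implicit Arguments.
Unset Strict Implicit.
Unset Printing Implicit Defensive.

Import Order.TTheory GRing.Theory Num.Theory.
Import numFieldNormedType.Exports.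

Local Open Scope classical_set_scope.
Local Open Scope ring_scope.
Local Open Scope convex_scope.

Definition dotcv (R : realType) (n : nat) (u v : 'cV[R]_n) : R :=
  (u^T *m v) 0 0.

(* The order dual of [convex_function]. *)
Definition concave_function (R : numFieldType) (E : lmodType R)
    (E' := convex_lmodType E) (D : set E') (f : E' -> R^o) : Prop :=
  forall t : {i01 R},
    {in D &, forall x y : E', (f x <| t |> f y <= f (x <| t |> y))%R}.

(* The vector of partial derivatives; [derive] is total, so this is the gradient
   only at points where [f] is differentiable. *)
Definition gradient (R : realType) (n : nat) (f : 'cV[R]_n -> R)
    (p : 'cV[R]_n) : 'cV[R]_n :=
  \col_(i < n) 'D_(delta_mx i 0 : 'cV[R]_n) f p.

(* The convention 0 ln 0 = 0 is automatic: [ln 0] is a real number (namely 0). *)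
Definition entropy (R : realType) (d : nat) (x : 'cV[R]_d) : \bar R :=
  if [forall i, 0 <= x i 0] then (\sum_(i < d) x i 0 * ln (x i 0))%:E
  else +oo%E.

Definition lagrangian (R : realType) (m d : nat) (A : 'M[R]_(m, d))
    (b : 'cV[R]_m) (c : 'cV[R]_d) (eps : R) (x : 'cV[R]_d) (lam : 'cV[R]_m) :
    \bar R :=
  ((dotcv c x + dotcv lam (b - A *m x))%:E + eps%:E * entropy x)%E.

Definition edual (R : realType) (m d : nat) (A : 'M[R]_(m, d))
    (b : 'cV[R]_m) (c : 'cV[R]_d) (eps : R) (lam : 'cV[R]_m) : \bar R :=
  ereal_inf (range (fun x : 'cV[R]_d => lagrangian A b c eps x lam)).

(* Meaningful where [edual] is finite, since [fine] sends infinities to 0. *)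
Definition dual_fun (R : realType) (m d : nat) (A : 'M[R]_(m, d))
    (b : 'cV[R]_m) (c : 'cV[R]_d) (eps : R) (lam : 'cV[R]_m) : R :=
  fine (edual A b c eps lam).

Definition xstar (R : realType) (m d : nat) (A : 'M[R]_(m, d))
    (c : 'cV[R]_d) (eps : R) (lam : 'cV[R]_m) : 'cV[R]_d :=
  \col_(i < d) expR ((A^T *m lam - c) i 0 / eps - 1).

(* Main.v *)
(* The Lagrangian separates over the coordinates of [x], and each summand is
   minimized by the Fenchel-Young inequality [x ln x - x w >= - exp (w - 1)] for
   [x >= 0], with equality exactly at [x = exp (w - 1)]; it comes from
   [1 + z <= exp z] at [z = w - 1 - ln x].  Hence the infimum is attained at
   [xstar], which gives a closed form for the dual function, differentiable by the
   chain rule.  Concavity holds because the dual function is a pointwise minimum of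
   functions affine in the multiplier. *)
From HB Require Import structures.
Require Import Defs.
From mathcomp Require Import all_boot all_order all_algebra.
From mathcomp Require Import all_classical all_reals all_analysis.
From mathcomp Require Import ring lra.

Set Implicit Arguments.
Unset Strict Implicit.
Unset Printing Implicit Defensive.

Import Order.TTheory GRing.Theory Num.Theory.
Import numFieldNormedType.Exports.

Local Open Scope classical_set_scope.
Local Open Scope ring_scope.

Lemma xlnx_conjugate_ge (R : realType) (x w : R) :
  0 <= x -> - expR (w - 1) <= x * ln x - x * w.
Proof.
rewrite le_eqVlt => /predU1P[<-|x_gt0].
  (* Boundary case [x = 0]: the right side vanishes, and the exponential is nonnegative. *)
  by rewrite !mul0r subrr oppr_le0 expR_ge0.
have -> : expR (w - 1) = x * expR (w - 1 - ln x).
  by rewrite [in RHS]expRB lnK// mulrCA divff ?mulr1// gt_eqF.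
have := ler_wpM2l (ltW x_gt0) (expR_ge1Dx (w - 1 - ln x)).
lra.
Qed.

Lemma xlnx_conjugate_eq (R : realType) (w : R) :
  let x := expR (w - 1) in x * ln x - x * w = - x.
Proof. by move=> x; rewrite /x expRK; ring. Qed.

Section dotcv.
Context {R : realType}.

Lemma dotcvE n (u v : 'cV[R]_n) : dotcv u v = \sum_(i < n) u i 0 * v i 0.
Proof. by rewrite /dotcv mxE; apply: eq_bigr => i _; rewrite mxE. Qed.

Lemma dotcvC n (u v : 'cV[R]_n) : dotcv u v = dotcv v u.
Proof. by rewrite !dotcvE; apply: eq_bigr => i _; rewrite mulrC. Qed.

Lemma dotcv_is_linear n (u : 'cV[R]_n) : linear (dotcv u : _ -> R^o).
Proof. by move=> a v w; rewrite /dotcv linearP !mxE. Qed.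

HB.instance Definition _ n (u : 'cV[R]_n) :=
  GRing.isLinear.Build R 'cV[R]_n R^o *:%R (dotcv u) (dotcv_is_linear u).

Lemma dotcvBl n (u v w : 'cV[R]_n) : dotcv (u - v) w = dotcv u w - dotcv v w.
Proof. by rewrite ![dotcv _ w]dotcvC linearB. Qed.

Lemma dotcv_mulmxr m n (A : 'M[R]_(m, n)) (u : 'cV_m) (v : 'cV_n) :
  dotcv u (A *m v) = dotcv (A^T *m u) v.
Proof. by rewrite /dotcv trmx_mul trmxK mulmxA. Qed.

Lemma dotcv_delta n (u : 'cV[R]_n) (k : 'I_n) : dotcv u (delta_mx k 0) = u k 0.
Proof. by rewrite /dotcv -colE !mxE. Qed.

Lemma dotcv_col m n (A : 'M[R]_(m, n)) (i : 'I_n) (v : 'cV_m) :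
  dotcv (col i A) v = (A^T *m v) i 0.
Proof. by rewrite dotcvE !mxE; apply: eq_bigr => j _; rewrite !mxE. Qed.

(** A finite combination of coordinate projections, each of them differentiable. Continuity is what
    [diff_lin] asks of a linear map. *)
Lemma dotcv_continuous n (u : 'cV[R]_n) : continuous (dotcv u : 'cV[R]_n -> R^o).
Proof.
have -> : (dotcv u : 'cV[R]_n -> R^o) =
    \sum_(i < n) (u i 0 \*: (fun v : 'cV[R]_n => v i 0 : R^o)).
  by apply/funext => v; rewrite fct_sumE dotcvE.
move=> v; apply: differentiable_continuous; apply: differentiable_sum => i.
exact/differentiableZ/differentiable_coord.
Qed.

Lemma is_diff_dotcv n (u v : 'cV[R]_n) :
  is_diff v (dotcv u : 'cV[R]_n -> R^o) (dotcv u).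
Proof.
apply: DiffDef; first exact/linear_differentiable/dotcv_continuous.
by rewrite diff_lin//; exact: dotcv_continuous.
Qed.

End dotcv.

Lemma is_diff_expR_comp (R : realType) (V : normedModType R) (f df : V -> R^o)
    (x : V) :
  is_diff x f df -> is_diff x (expR \o f : V -> R^o)
    (fun v => expR (f x) * df v).
Proof.
(* In one variable the differential is multiplication by the derivative; the chain rule then gives
   the result up to commutativity. *)
move=> dfx; have dexp : is_diff (f x) (expR : R^o -> R^o) (fun h => h * expR (f x)).
  have dE : differentiable (expR : R^o -> R^o) (f x).
    exact/derivable1_diffP/derivable_expR.
  apply: DiffDef => //; rewrite diff1E// derive1E.
  by apply/funext => h; congr (_ * _); exact: derive_val.
apply: is_diff_eq; apply/funext => v /=; exact: mulrC.
Qed.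

Section entropic_dual.
Context {R : realType} {m d : nat}.
Variables (A : 'M[R]_(m, d)) (b : 'cV[R]_m) (c : 'cV[R]_d) (eps : R).
Hypothesis eps_gt0 : 0 < eps.

Let w (lam : 'cV[R]_m) (i : 'I_d) : R := (A^T *m lam - c) i 0 / eps.

(** The Lagrangian on the nonnegative orthant, as a real number. The linear part has coefficient
    [(c - A^T *m lam) i 0 = - eps * w lam i] at [x i 0], so [eps] factors out and each summand has
    the shape treated by [xlnx_conjugate_ge]. *)
Let L (x : 'cV[R]_d) (lam : 'cV[R]_m) : R :=
  dotcv b lam + eps * \sum_(i < d) (x i 0 * ln (x i 0) - x i 0 * w lam i).

Lemma xstar_gt0 lam i : 0 < xstar A c eps lam i 0.
Proof. by rewrite mxE expR_gt0. Qed.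

Let lagrangianE (x : 'cV[R]_d) (lam : 'cV[R]_m) : (forall i, 0 <= x i 0) ->
  lagrangian A b c eps x lam = (L x lam)%:E.
Proof.
move=> x_ge0; rewrite /lagrangian /entropy.
case: ifPn => [_|/negP[]]; last exact/forallP.
rewrite -EFinM -EFinD; congr EFin.
rewrite /L linearB/= dotcv_mulmxr [dotcv lam b]dotcvC sumrB mulrBr.
have -> : eps * (\sum_(i < d) x i 0 * w lam i) = dotcv (A^T *m lam - c) x.
  rewrite dotcvE mulr_sumr; apply: eq_bigr => i _.
  by rewrite /w; field; rewrite gt_eqF.
by rewrite dotcvBl; ring.
Qed.

Let L_xstar lam :
  L (xstar A c eps lam) lam
  = dotcv b lam - eps * \sum_(i < d) xstar A c eps lam i 0.
Proof.
rewrite /L -mulrN -sumrN; congr (_ + _ * _); apply: eq_bigr => i _.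
by rewrite mxE; exact: xlnx_conjugate_eq.
Qed.

Let L_xstar_le (x : 'cV[R]_d) (lam : 'cV[R]_m) : (forall i, 0 <= x i 0) ->
  L (xstar A c eps lam) lam <= L x lam.
Proof.
move=> x_ge0; rewrite L_xstar /L -mulrN -sumrN lerD2l ler_pM2l//.
by apply: ler_sum => i _; rewrite [in leLHS]mxE; exact: xlnx_conjugate_ge.
Qed.

Lemma edual_xstar lam :
  edual A b c eps lam = lagrangian A b c eps (xstar A c eps lam) lam.
Proof.
apply/eqP; rewrite eq_le; apply/andP; split.
  by apply: ereal_inf_lbound; exists (xstar A c eps lam).
apply: le_ereal_inf_tmp => _ [x _ <-].
rewrite lagrangianE => [|i]; last exact/ltW/xstar_gt0.
case: (boolP [forall i, 0 <= x i 0]) => [/forallP x_ge0|x_nge0].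
  by rewrite lagrangianE// lee_fin L_xstar_le.
(* Outside the orthant the entropy is [+oo], and so is its product with [eps > 0]. *)
by rewrite /lagrangian /entropy (negbTE x_nge0) gt0_muley ?lte_fin// leey.
Qed.

Let edualE lam : edual A b c eps lam = (L (xstar A c eps lam) lam)%:E.
Proof. by rewrite edual_xstar lagrangianE// => i; exact/ltW/xstar_gt0. Qed.

Lemma edual_fin_num lam : edual A b c eps lam \is a fin_num.
Proof. by rewrite edualE. Qed.

Lemma dual_funE lam : dual_fun A b c eps lam
  = dotcv b lam - eps * \sum_(i < d) xstar A c eps lam i 0.
Proof. by rewrite /dual_fun edualE L_xstar. Qed.

Let dual_fun_le (x : 'cV[R]_d) (lam : 'cV[R]_m) :
  (forall i, 0 <= x i 0) -> dual_fun A b c eps lam <= L x lam.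
Proof. by move=> x_ge0; rewrite dual_funE -L_xstar L_xstar_le. Qed.

Lemma dual_fun_concave : concave_function setT (dual_fun A b c eps).
Proof.
move=> t lam mu _ _.
pose nu : 'cV[R]_m := t%:num *: (lam : 'cV[R]_m) + (1 - t%:num) *: (mu : 'cV[R]_m).
(* Unfolds both convex combinations, in [R^o] and in the space of multipliers. *)
change (t%:num * dual_fun A b c eps lam + (1 - t%:num) * dual_fun A b c eps mu
  <= dual_fun A b c eps nu).
have L_affine x : L x nu = t%:num * L x lam + (1 - t%:num) * L x mu.
  have w_affine i : w nu i = t%:num * w lam i + (1 - t%:num) * w mu i.
    by rewrite /w /nu linearD !linearZ/= !mxE; ring.
  have sum_affine :
      \sum_i (x i 0 * ln (x i 0) - x i 0 * w nu i)
      = t%:num * (\sum_i (x i 0 * ln (x i 0) - x i 0 * w lam i))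
        + (1 - t%:num) * (\sum_i (x i 0 * ln (x i 0) - x i 0 * w mu i)).
    rewrite !mulr_sumr -big_split/=; apply: eq_bigr => i _.
    by rewrite w_affine; ring.
  have b_affine : dotcv b nu = t%:num * dotcv b lam + (1 - t%:num) * dotcv b mu.
    by rewrite linearD !linearZ.
  by rewrite /L sum_affine b_affine; ring.
(* The minimizer at [nu] is kept as a common test point: [L] splits there along [lam] and [mu], and
   each piece bounds the corresponding dual value from above. *)
rewrite [leRHS]dual_funE -L_xstar L_affine.
have x_ge0 i : 0 <= xstar A c eps nu i 0 by exact/ltW/xstar_gt0.
by apply: lerD; apply: ler_wpM2l; rewrite ?subr_ge0 ?dual_fun_le.
Qed.

(** The exponent of [xstar] in point-free form, linear part minus constant, so that the
    differentiation rules match it syntactically. *)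
Let aff (i : 'I_d) : 'cV[R]_m -> R^o :=
  eps^-1 \*: dotcv (col i A) - cst (c i 0 / eps + 1).

Let expR_aff i lam : expR (aff i lam) = xstar A c eps lam i 0.
Proof.
rewrite mxE; congr expR.
change (eps^-1 * dotcv (col i A) lam - (c i 0 / eps + 1)
  = (A^T *m lam - c) i 0 / eps - 1).
by rewrite dotcv_col [RHS]/= [in RHS]mxE [(- c) i 0]mxE; ring.
Qed.

Let dual_fun_sum : dual_fun A b c eps =
  dotcv b - eps \*: \sum_(i < d) (expR \o aff i) :> ('cV[R]_m -> R^o).
Proof.
apply/funext => lam; rewrite dual_funE [RHS]/=; congr (_ - _ * _).
by rewrite fct_sumE; apply: eq_bigr => i _; rewrite -expR_aff.
Qed.

Let is_diff_expR_aff i lam : is_diff lam (expR \o aff i : _ -> R^o)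
  (fun v => xstar A c eps lam i 0 * (eps^-1 * dotcv (col i A) v)).
Proof.
have dcol := is_diff_dotcv (col i A) lam.
have daff : is_diff lam (aff i) (eps^-1 \*: dotcv (col i A)).
  (* The constant contributes a zero differential. *)
  by apply: is_diff_eq; rewrite subr0.
apply: is_diff_eq (is_diff_expR_comp daff) _.
by apply/funext => v; rewrite expR_aff.
Qed.

Lemma dual_fun_differentiable lam : differentiable (dual_fun A b c eps) lam.
Proof.
rewrite dual_fun_sum; apply: differentiableB.
  by have [] := is_diff_dotcv b lam.
by apply/differentiableZ/differentiable_sum => i; have [] := is_diff_expR_aff i lam.
Qed.

Lemma gradient_dual_fun lam :
  gradient (dual_fun A b c eps) lam = b - A *m xstar A c eps lam.
Proof.
(* Derivative along an arbitrary [v]; the partial derivatives are the cases [v = delta_mx k 0]. *)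
have dG v : is_derive lam v (dual_fun A b c eps : _ -> R^o)
    (dotcv b v - eps * \sum_(i < d)
       (xstar A c eps lam i 0 * (eps^-1 * (A^T *m v) i 0))).
  rewrite dual_fun_sum; apply: is_deriveB.
    have dx := is_diff_dotcv b lam.
    by apply: DeriveDef; [exact: diff_derivable|rewrite deriveE// diff_val].
  apply: is_deriveZ; apply: is_derive_sum => i.
  have dx := is_diff_expR_aff i lam.
  apply: DeriveDef; first exact: diff_derivable.
  by rewrite deriveE// diff_val dotcv_col.
apply/colP => k; rewrite !mxE (@derive_val _ _ _ _ _ _ _ (dG _)) dotcv_delta.
congr (_ - _); rewrite mulr_sumr; apply: eq_bigr => i _.
(* [A^T *m delta_mx k 0] is column [k] of [A^T], with entries [A k i], and [eps] cancels
   [eps^-1]. *)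
by rewrite -colE !mxE; field; rewrite gt_eqF.
Qed.

End entropic_dual.

Theorem lemma2p1 (R : realType) (m d : nat) (A : 'M[R]_(m, d))
    (b : 'cV[R]_m) (c : 'cV[R]_d)
    (hA : exists lam0 : 'cV[R]_m, forall i : 'I_d, 0 < (A^T *m lam0) i 0)
    (eps : R) (eps_gt0 : 0 < eps) :
  [/\ forall lam : 'cV[R]_m, edual A b c eps lam \is a fin_num,
      concave_function setT (dual_fun A b c eps),
      forall lam : 'cV[R]_m, differentiable (dual_fun A b c eps) lam &
      forall lam : 'cV[R]_m,
        [/\ forall i : 'I_d, 0 < xstar A c eps lam i 0,
            (dual_fun A b c eps lam)%:E
              = lagrangian A b c eps (xstar A c eps lam) lam,
            dual_fun A b c eps lam
              = dotcv b lam - eps * \sum_(i < d) xstar A c eps lam i 0 &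
            gradient (dual_fun A b c eps) lam = b - A *m xstar A c eps lam]].
Proof.
split; first exact: edual_fin_num.
- exact: dual_fun_concave.
- exact: dual_fun_differentiable.
move=> lam; split; first exact: xstar_gt0.
- by rewrite -edual_xstar// fineK// edual_fin_num.
- exact: dual_funE.
- exact: gradient_dual_fun.
Qed.
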